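(* Formulation F7 is strictly tighter than Formulation F2 (both defined in the context). Explicitly: (i) for every instance $(T,M,(W_m)_{m\in M})$ and every continuous solution $(X,S)$ of F7, the component $X$ is a continuous solution of F2; and (ii) there exist an instance and a continuous solution $X$ of F2 for that instance such that there is no $S$ for which $(X,S)$ is a continuous solution of F7.
   Context: An instance of the generator maintenance scheduling problem consists of a horizon $T=\{1,2,\dots,|T|\}$ of periods, a finite nonempty set $M$ of maintenances, and a positive integer duration $W_m$ for each $m\in M$. The variables are $X_{t,m}$ (maintenance $m$ is executed in period $t$) and $S_{t,m}$ (maintenance $m$ starts in period $t$), for $t\in T$, $m\in M$. Conventions: $X_{t,m}=0$ whenever $t\le 0$ or $t>|T|$; $S_{t,m}=0$ whenever $t\le 0$, $t>|T|$, or $t\ge |T|-W_m+2$ (a maintenance cannot start so late that it would not finish within the horizon). In particular every solution involving $S$ is required to satisfy $S_{t,m}=0$ for $t\in T$ with $t\ge |T|-W_m+2$. Formulation F2 (variables $X$ only): $\sum_{t\in T}X_{t,m}=W_m$ for all $m\in M$; $X_{t,m}-X_{t-1,m}\le X_{l,m}$ for all $t\in T$, $m\in M$, $l\in\{t,\dots,t+W_m-1\}$; $X_{t,m}\in\{0,1\}$ for all $t\in T$, $m\in M$. Formulation F7 (variables $X,S$): $\sum_{t\in T}S_{t,m}=1$ for all $m\in M$; $\sum_{t'=t-W_m+1}^{t}S_{t',m}=X_{t,m}$ for all $t\in T$, $m\in M$; $X_{t,m},S_{t,m}\in\{0,1\}$ for all $t\in T$, $m\in M$. A continuous solution of a formulation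 is a real assignment of its variables satisfying its linear relaxation, i.e. all its constraints with each condition ''$\in\{0,1\}$'' replaced by ''$\in[0,1]$''. A formulation A is at least as tight as B if all continuous solutions satisfying A also satisfy B; A is strictly tighter than B if A is at least as tight as B and there is at least one continuous solution satisfying B that does not satisfy A. Since F2 has only the variables $X$, the comparison is in terms of $X$: a given $X$ satisfies F7 when some $S$ completes it to a continuous solution of F7. *)

(* Defs.v *)
From HB Require Import structures.
From mathcomp Require Import all_boot all_order all_algebra.
From mathcomp Require Import reals.

Set Implicit Arguments.
Unset Strict Implicit.
Unset Printing Implicit Defensive.

Import Order.TTheory GRing.Theory Num.Theory.

Local Open Scope ring_scope.

Record instance := Instance {
  horizon : nat;
  maintenance : finType;
  duration : maintenance -> nat;
  maintenance_nonempty : (0 < #|maintenance|)%N;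
  duration_gt0 : forall m, (0 < duration m)%N
}.

(* The index i : 'I_(horizon I) stands for the period i + 1, so that the      *)
(* periods are 1, ..., horizon I.                                             *)
Definition period (I : instance) := 'I_(horizon I).

Definition time (I : instance) (i : period I) : int := i.+1%:Z.

Section Formulations.
Variable R : realType.

Definition assignment (I : instance) := period I -> maintenance I -> R.

(* [at_time V t m] is V_{t,m} for an arbitrary integer t, equal to 0 when     *)
(* t is not in {1, ..., horizon I}.                                           *)
Definition at_time (I : instance) (V : assignment I) (t : int)
    (m : maintenance I) : R :=
  match t with
  | Posz k.+1 => if insub k is Some i then V i m else 0
  | _ => 0
  end.

(* A formulation, viewed as a predicate on the variables X, is parameterized  *)
(* by the domain required of each variable: [binary] gives the formulation    *)
(* itself and [unit_interval] gives its linear relaxation.                    *)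
Definition formulation := pred R -> forall I : instance, assignment I -> Prop.

Definition binary : pred R := fun x => (x == 0) || (x == 1).

Definition unit_interval : pred R := fun x => 0 <= x <= 1.

Definition F2 : formulation := fun dom I X =>
  [/\ forall m : maintenance I, \sum_(i : period I) X i m = (duration m)%:R,
      forall (i : period I) (m : maintenance I) (l : int),
        time i <= l <= time i + (duration m)%:Z - 1 ->
        at_time X (time i) m - at_time X (time i - 1) m <= at_time X l m
    & forall (i : period I) (m : maintenance I), dom (X i m)].

(* The second constraint is the convention that a maintenance cannot start    *)
(* too late to finish. In the third one the summation index is                *)
(* t' = t - W_m + 1 + k for k = 0, ..., W_m - 1.                              *)
Definition F7 (dom : pred R) (I : instance) (X S : assignment I) : Prop :=
  [/\ forall m : maintenance I, \sum_(i : period I) S i m = 1,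
      forall (i : period I) (m : maintenance I),
        (horizon I)%:Z - (duration m)%:Z + 2 <= time i -> S i m = 0,
      forall (i : period I) (m : maintenance I),
        \sum_(k < duration m)
          at_time S (time i - (duration m)%:Z + 1 + k%:Z) m
        = at_time X (time i) m
    & forall (i : period I) (m : maintenance I), dom (X i m) && dom (S i m)].

Definition F7_in_X : formulation := fun dom I X =>
  exists S : assignment I, F7 dom X S.

Definition continuous_solution (A : formulation) (I : instance)
    (X : assignment I) : Prop := A unit_interval I X.

Definition at_least_as_tight (A B : formulation) : Prop :=
  forall (I : instance) (X : assignment I),
    continuous_solution A X -> continuous_solution B X.

Definition strictly_tighter (A B : formulation) : Prop :=
  at_least_as_tight A B /\
  exists (I : instance) (X : assignment I),
    continuous_solution B X /\ ~ continuous_solution A X.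

End Formulations.

(* Main.v *)
Require Import Defs.
From mathcomp Require Import all_boot all_order all_algebra.
From mathcomp Require Import reals.
From mathcomp Require Import zify lra.

(** Fix a maintenance of duration W and let (X, S) be a continuous solution of
    the start-based formulation, both variables being extended by 0 outside the
    horizon.  Since late starts are forbidden, X is the moving sum of S over
    windows of length W at every integer time, not only inside the horizon
    ([F7_window]).  The two families of constraints on X follow.
    - Total work: X is a sum of W delayed copies of S, the delays being
      0, ..., W - 1.  No mass of S leaves the horizon under such a delay, so
      each copy sums to 1 ([sum_delay]).
    - Contiguity: sliding the window by one period adds S_t and drops a
      nonnegative term, so X_t - X_{t-1} <= S_t ([window_sum_increment]);
      and S_t is one of the nonnegative terms of X_l whenever
      t <= l <= t + W - 1 ([term_le_window_sum]).

    The inclusion is strict already for one maintenance of duration 2 and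
    three periods.  There S_3 = 0, hence X_1 = S_1 and X_3 = S_2 + S_3, so
    X_1 + X_3 = 1 is forced.  The constant assignment 2/3 meets the X-only
    constraints, but X_1 + X_3 = 4/3. *)

Set Implicit Arguments.
Unset Strict Implicit.
Unset Printing Implicit Defensive.

Import Order.TTheory GRing.Theory Num.Theory.

Local Open Scope ring_scope.

(** * Moving sums of sequences indexed by the integers *)

Definition window_sum (R : nmodType) (g : int -> R) (w : nat) (t : int) : R :=
  \sum_(k < w) g (t - w%:Z + 1 + k%:Z).

(** Increasing the delay by one period brings in the value at a nonpositive time
    and pushes out the value at time n - d; both vanish, whence an induction
    on the delay. *)
Lemma sum_delay (R : nmodType) (g : int -> R) (n d : nat) :
    (forall t, t <= 0 -> g t = 0) ->
    (forall t, n%:Z - d%:Z < t -> g t = 0) ->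
  \sum_(i < n) g (i.+1%:Z - d%:Z) = \sum_(i < n) g i.+1%:Z.
Proof.
move=> g_le0; elim: d => [|d IHd] g_late.
  by apply: eq_bigr => i _; rewrite subr0.
rewrite -IHd; last by move=> t lt_t; apply: g_late; lia.
case: n g_late {IHd} => [|n] g_late; first by rewrite !big_ord0.
rewrite big_ord_recl big_ord_recr /= g_le0 ?add0r; last by lia.
rewrite [g (n.+1%:Z - d%:Z)]g_late ?addr0; last by lia.
by apply: eq_bigr => i _; congr g; rewrite /bump /=; lia.
Qed.

Lemma window_sum_increment (R : numDomainType) (g : int -> R) (w : nat)
    (t : int) :
  (0 < w)%N -> (forall s, 0 <= g s) ->
  window_sum g w t - window_sum g w (t - 1) <= g t.
Proof.
case: w => // w _ g_ge0; rewrite /window_sum big_ord_recr big_ord_recl /=.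
have -> : t - w.+1%:Z + 1 + w%:Z = t by lia.
under [X in _ - (_ + X)]eq_bigr => i _.
  have -> : t - 1 - w.+1%:Z + 1 + (bump 0 i)%:Z = t - w.+1%:Z + 1 + i%:Z.
    by rewrite /bump /=; lia.
  over.
by rewrite lerBlDr addrC lerD2l lerDr.
Qed.

Lemma term_le_window_sum (R : numDomainType) (g : int -> R) (w : nat)
    (t l : int) :
  (forall s, 0 <= g s) -> t <= l <= t + w%:Z - 1 -> g t <= window_sum g w l.
Proof.
move=> g_ge0 /andP[le_tl le_lt].
have lt_k : (`|(t - l + w%:Z - 1)%R|%N < w)%N by lia.
rewrite /window_sum (bigD1 (Ordinal lt_k)) //=.
have -> : l - w%:Z + 1 + (`|(t - l + w%:Z - 1)%R|%N)%:Z = t by lia.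
by rewrite lerDl sumr_ge0.
Qed.

(** * Assignments extended by zero outside the horizon *)

Section Extension.
Variables (R : realType) (I : instance).
Implicit Types (V : assignment R I) (m : maintenance I).

Lemma at_time_time V (i : period I) m : at_time V (time i) m = V i m.
Proof. by rewrite /at_time /time /= valK. Qed.

Lemma at_time_out V (t : int) m :
  (t <= 0) || ((horizon I)%:Z < t) -> at_time V t m = 0.
Proof.
case: t => [[|k]|k] //= out_k; case: insubP => // i lt_k _.
by exfalso; move: out_k lt_k; lia.
Qed.

Lemma time_or_out (t : int) :
  (exists i : period I, t = time i) \/ (t <= 0) || ((horizon I)%:Z < t).
Proof.
case: (boolP ((t <= 0) || ((horizon I)%:Z < t))) => [|in_t]; first by right.
have lt_k : (`|t|.-1 < horizon I)%N by lia.
by left; exists (Ordinal lt_k); rewrite /time /=; lia.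
Qed.

Lemma at_time_ge0 V m :
  (forall i, 0 <= V i m) -> forall t, 0 <= at_time V t m.
Proof.
move=> V_ge0 t; have [[i ->]|out_t] := time_or_out t.
  by rewrite at_time_time.
by rewrite at_time_out.
Qed.

End Extension.

(** * Start variables dominate the X-only formulation *)

Section Tightness.
Variables (R : realType) (I : instance) (X S : assignment R I).
Hypothesis XS_F7 : F7 (@unit_interval R) X S.

Lemma F7_late_start (m : maintenance I) (t : int) :
  (horizon I)%:Z - (duration m)%:Z + 2 <= t -> at_time S t m = 0.
Proof.
case: XS_F7 => _ late _ _ le_t; have [[i eq_t]|out_t] := time_or_out I t.
  by rewrite eq_t at_time_time late // -eq_t.
exact: at_time_out.
Qed.

(** Before the horizon the window only meets nonpositive times; after it, the
    window only meets forbidden start times. *)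
Lemma F7_window (m : maintenance I) (t : int) :
  at_time X t m = window_sum (fun s => at_time S s m) (duration m) t.
Proof.
case: XS_F7 => _ _ link _; have [[i ->]|out_t] := time_or_out I t.
  by rewrite -link.
rewrite at_time_out // /window_sum big1 // => k _; have lt_k := ltn_ord k.
case/orP: out_t => out_t; first by rewrite at_time_out //; lia.
by apply: F7_late_start; lia.
Qed.

Lemma F7_total_work (m : maintenance I) :
  \sum_(i : period I) X i m = (duration m)%:R.
Proof.
have sumS : \sum_(i : period I) at_time S (time i) m = 1.
  case: XS_F7 => sum1 _ _ _; rewrite -(sum1 m).
  by apply: eq_bigr => i _; rewrite at_time_time.
under eq_bigr => i _ do rewrite -at_time_time F7_window /window_sum.
rewrite exchange_big /=; set W := duration m.
rewrite -[RHS]/(1 *+ W) -[in RHS](card_ord W) -sumr_const.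
apply: eq_bigr => k _; have lt_k := ltn_ord k; rewrite -sumS.
(* The k-th term of the window ending at t is S delayed by W - 1 - k. *)
rewrite -(@sum_delay _ (fun s => at_time S s m) _ (W - 1 - k)).
- by apply: eq_bigr => i _; congr at_time; rewrite /time; lia.
- by move=> t t_le0; rewrite at_time_out ?t_le0.
- by move=> t lt_t; apply: F7_late_start; rewrite -/W; lia.
Qed.

Lemma F7_sub_F2 : F2 (@unit_interval R) X.
Proof.
case: (XS_F7) => _ _ _ dom; split=> [m|i m l le_l|i m].
- exact: F7_total_work.
- have S_ge0 : forall s, 0 <= at_time S s m.
    by apply: at_time_ge0 => j; have /andP[_ /andP[]] := dom j m.
  rewrite !F7_window.
  apply: (@le_trans _ _ (at_time S (time i) m)).
    exact: (window_sum_increment _ (duration_gt0 m) S_ge0).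
  exact: (term_le_window_sum S_ge0 le_l).
- by have /andP[] := dom i m.
Qed.

End Tightness.

(** * A fractional solution that no start variables complete *)

Lemma unit_nonempty : (0 < #|{: unit}|)%N.
Proof. by rewrite card_unit. Qed.

Definition two_of_three : instance :=
  @Instance 3 unit (fun=> 2%N) unit_nonempty (fun=> isT).

Definition two_thirds (R : realType) : assignment R two_of_three :=
  fun _ _ => 2 / 3.

Lemma two_thirds_F2 (R : realType) : F2 (@unit_interval R) (two_thirds R).
Proof.
split=> [[]|i [] l|i m]; last by rewrite /unit_interval /two_thirds; lra.
  by rewrite /two_thirds /= !big_ord_recl big_ord0 /=; lra.
rewrite at_time_time => /andP[le_il le_li].
have ge0 : forall t, 0 <= at_time (two_thirds R) t tt.
  by apply: at_time_ge0 => j; rewrite /two_thirds; lra.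
have [[j ->]|out_l] := time_or_out two_of_three l.
  by rewrite at_time_time lerBlDr lerDl ge0.
(* An execution past the horizon can only be asked of the last period, whose
   predecessor carries the same value. *)
have i_pos : (0 < i)%N.
  by move: out_l le_il le_li; rewrite /time /=; lia.
have [[j ->]|out_i] := time_or_out two_of_three (time i - 1).
  by rewrite at_time_time /two_thirds subrr.
have lt_i : (i < 3)%N := ltn_ord i.
by exfalso; move: i_pos lt_i out_i; rewrite /time /=; lia.
Qed.

Lemma two_thirds_not_F7 (R : realType) :
  ~ F7_in_X (@unit_interval R) (two_thirds R).
Proof.
case=> S XS_F7; case: (XS_F7) => sumS _ _ _.
have window t : at_time (two_thirds R) t tt = at_time S (t - 1) tt + at_time S t tt.
  rewrite (F7_window XS_F7) /window_sum !big_ord_recl big_ord0 !addr0 /=.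
  by congr (_ + _); apply: (congr1 (at_time S ^~ tt)); rewrite ?/bump /=; lia.
have X_const (i : period two_of_three) : at_time (two_thirds R) (time i) tt = 2 / 3.
  by rewrite at_time_time.
have X1 := X_const (inord 0); have X3 := X_const (inord 2).
have S3 := F7_late_start (m := tt) XS_F7 (t := 3) isT.
have S0 : at_time S (1 - 1) tt = 0 by rewrite at_time_out.
have sum1 : at_time S 1 tt + at_time S 2 tt + at_time S 3 tt = 1.
  rewrite -(sumS tt); under eq_bigr do rewrite -at_time_time.
  by rewrite !big_ord_recl big_ord0 addr0 addrA.
move: X1 X3; rewrite /time !inordK // !window S0 (_ : 3%:Z - 1 = 2) //.
by move: S3 sum1; lra.
Qed.

Theorem proposition3p2 (R : realType) :
  strictly_tighter (@F7_in_X R) (@F2 R).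
Proof.
split=> [I X [S XS_F7]|]; first exact: F7_sub_F2 XS_F7.
exists two_of_three, (two_thirds R); split; first exact: two_thirds_F2.
exact: two_thirds_not_F7.
Qed.
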